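(* For every infinite compact metric space $(X,d)$, the space $(\mathbb{N},\varrho_X)$ is isometric to a dense subset of $X$.
   Context: Here $\mathbb{N}=\{0,1,2,\ldots\}$, and for an infinite compact metric space $(X,d)$ the metric $\varrho_X$ on $\mathbb{N}$ is constructed recursively as follows. On $\{0\}$ it is the trivial metric. Suppose that for some $n\in\mathbb{N}$ the metric $\varrho_X$ has been defined on $\{0,\ldots,n\}$ so that $(\{0,\ldots,n\},\varrho_X)$ embeds isometrically into $X$. Put $$F_n:=\{(x_0,\ldots,x_n)\in X^{n+1}: d(x_j,x_k)=\varrho_X(j,k),\ j,k=0,\ldots,n\},$$ $$f_n\colon F_n\times X\to\mathbb{R},\quad f_n(x_0,\ldots,x_n;x):=\min(d(x_0,x),\ldots,d(x_n,x)),$$ $$A_0^{n+1}:=\{(x;y)\in F_n\times X: f_n(x;y)=\max f_n(F_n\times X)\},$$ and for $j=1,\ldots,n+1$ inductively $$A_j^{n+1}:=\bigl\{(y_0,\ldots,y_n;y)\in A_{j-1}^{n+1}: d(y_{j-1},y)=\max\{d(x_{j-1},x): (x_0,\ldots,x_n;x)\in A_{j-1}^{n+1}\}\bigr\}.$$ All these sets are nonempty. Take any $(x_0,\ldots,x_n;x_{n+1})\in A_{n+1}^{n+1}$ and put $\varrho_X(j,n+1)=\varrho_X(n+1,j):=d(x_j,x_{n+1})$ for $j=0,\ldots,n+1$. This does not depend on the choice of the element of $A_{n+1}^{n+1}$ and yields a metric on $\{0,\ldots,n+1\}$ for which this set embeds isometrically into $X$. *)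

(* Defs.v *)
From HB Require Import structures.
From mathcomp Require Import all_boot all_order all_algebra.
From mathcomp Require Import all_classical all_reals all_analysis.

Set Implicit Arguments.
Unset Strict Implicit.
Unset Printing Implicit Defensive.

Import Order.TTheory GRing.Theory Num.Theory.
Local Open Scope classical_set_scope.
Local Open Scope ring_scope.

Definition is_max (R : realType) (S : set R) (m : R) : Prop :=
  S m /\ ubound S m.

(* An element (x_0, ..., x_n; x) of X^{n+1} * X. *)
Definition conf (X : Type) (n : nat) : Type := (('I_n.+1 -> X) * X)%type.

(* x_j for j <= n, and the last point x for j = n+1 (and any larger j). *)
Definition pt (X : Type) (n : nat) (p : conf X n) (j : nat) : X :=
  oapp p.1 p.2 (insub j).

(* In what follows [r] is a metric on {0, ..., n}; its values at other
   arguments are never used. *)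
Definition Fset (R : realType) (X : metricType R) (n : nat)
    (r : nat -> nat -> R) : set ('I_n.+1 -> X) :=
  [set x | forall j k : 'I_n.+1, mdist (x j) (x k) = r j k].

Definition fmin (R : realType) (X : metricType R) (n : nat)
    (p : conf X n) : R :=
  \big[Num.min/mdist (p.1 ord0) p.2]_(j < n.+1) mdist (p.1 j) p.2.

(* [Aset X n r j] is A_j^{n+1}. *)
Fixpoint Aset (R : realType) (X : metricType R) (n : nat)
    (r : nat -> nat -> R) (j : nat) : set (conf X n) :=
  match j with
  | 0 => [set p | (@Fset R X n r `*` [set: X]) p /\
           is_max [set fmin q | q in @Fset R X n r `*` [set: X]] (fmin p)]
  | i.+1 => [set p | @Aset R X n r i p /\
           is_max [set mdist (pt q i) q.2 | q in @Aset R X n r i]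
                  (mdist (pt p i) p.2)]
  end.

Arguments Aset {R} X n r j _.

Definition extend_metric (R : realType) (X : metricType R) (n : nat)
    (r : nat -> nat -> R) (p : conf X n) : nat -> nat -> R :=
  fun j k => if k == n.+1 then mdist (pt p j) p.2
             else if j == n.+1 then mdist (pt p k) p.2
             else r j k.

(* [rho_stage X n] is the metric on {0, ..., n} obtained after n steps. The
   choice is made among the metrics r' induced by the elements of
   A_{n+1}^{n+1}, so that no default point of X is needed; by
   [Aset_dist_unique] all of them agree on {0, ..., n+1}. *)
Fixpoint rho_stage (R : realType) (X : metricType R) (n : nat) :
    nat -> nat -> R :=
  match n with
  | 0 => fun _ _ => 0
  | m.+1 => let r := rho_stage X m in
      xget r [set extend_metric r p | p in Aset X m r m.+1]
  end.

Definition rho (R : realType) (X : metricType R) (j k : nat) : R :=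
  rho_stage X (maxn j k) j k.

Lemma Aset_dist_unique (R : realType) (X : metricType R) (n : nat)
    (r : nat -> nat -> R) (p q : conf X n) :
  Aset X n r n.+1 p -> Aset X n r n.+1 q ->
  forall j, (j <= n.+1)%N -> mdist (pt p j) p.2 = mdist (pt q j) q.2.
Proof.
have sub m : Aset X n r m.+1 `<=` Aset X n r m by move=> u [].
have anti m i : (i <= m)%N -> Aset X n r m `<=` Aset X n r i.
  elim: m => [|m IH]; first by rewrite leqn0 => /eqP ->.
  by rewrite leq_eqVlt => /predU1P[->//|im] u /sub; exact: IH.
move=> Ap Aq j; rewrite leq_eqVlt => /predU1P[->|jn].
  by rewrite /pt insubF ?ltnn //= !mdistxx.
have [_ [pv pu]] := anti _ _ jn _ Ap.
have [_ [qv qu]] := anti _ _ jn _ Aq.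
by apply/eqP; rewrite eq_le qu // pu.
Qed.

(* Main.v *)
(* Call a sequence a farthest-first traversal if each new term lies as far from
   the set of the earlier ones as a point of the space can. In an infinite space
   such a sequence is injective; in a compact one its range is dense, since a
   point at distance at least e from the whole sequence would make the sequence
   e-separated. Every finite stage (N restricted to {0, ..., n}, rho) embeds
   isometrically into X, so by compactness of X^N there is a single sequence
   realizing all of rho; it is a farthest-first traversal because the point n+1
   was placed by maximizing the distance to the first n+1 points over all their
   isometric copies in X. *)
Require Import Defs.
From HB Require Import structures.
From mathcomp Require Import all_boot all_order all_algebra.
From mathcomp Require Import all_classical all_reals all_analysis.

Set Implicit Arguments.
Unset Strict Implicit.
Unset Printing Implicit Defensive.

Import Order.TTheory GRing.Theory Num.Theory.
Import numFieldNormedType.Exports.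
Local Open Scope classical_set_scope.
Local Open Scope ring_scope.

Section mdist_continuity.
Context {R : realFieldType} {X : metricType R}.

Lemma ler_dist_mdist (x y x' y' : X) :
  `|mdist x y - mdist x' y'| <= mdist x x' + mdist y y'.
Proof.
have le_add u v u' v' :
    mdist u v <= mdist u' v' + (mdist u u' + mdist v v') :> R.
  rewrite addrCA (metric_sym v) (le_trans (metric_triangle u u' v)) // lerD2l.
  exact: metric_triangle.
rewrite ler_norml lerBlDl le_add andbT lerNl opprB lerBlDl.
by rewrite (metric_sym x x') (metric_sym y y').
Qed.

Lemma cvg_mdist {T : Type} {F : set_system T} {FF : Filter F} (f g : T -> X)
    (x y : X) :
  f @ F --> x -> g @ F --> y -> mdist (f t) (g t) @[t --> F] --> mdist x y.
Proof.
move=> fx gy; apply/(@cvgrPdist_lt R R^o) => e e0.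
have e2 : 0 < e / 2 by rewrite divr_gt0.
near=> t; rewrite (le_lt_trans (ler_dist_mdist _ _ _ _)) // (splitr e) ltrD //.
- by near: t; exact: metricType_numDomainType.cvgr_dist_lt.
- by near: t; exact: metricType_numDomainType.cvgr_dist_lt.
Unshelve. all: by end_near. Qed.

Lemma continuous_mdist {T : topologicalType} (f g : T -> X) :
  continuous f -> continuous g -> continuous (fun t => mdist (f t) (g t)).
Proof. by move=> cf cg t; apply: cvg_mdist; [exact: cf|exact: cg]. Qed.

Lemma closed_mdist_eq {T : topologicalType} (f g : T -> X) (c : R) :
  continuous f -> continuous g -> closed [set t | mdist (f t) (g t) = c].
Proof.
move=> cf cg; apply: (@preimage_closed _ R _ [set x | x = c]).
  by move=> t _; exact: continuous_mdist.
exact: closed_eq.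
Qed.

End mdist_continuity.

Lemma compact_ptws (I : eqType) (T : topologicalType) :
  compact [set: T] -> compact [set: {ptws I -> T}].
Proof.
move=> cT; have := @tychonoff I (fun=> T) (fun=> [set: T]) (fun=> cT).
by congr compact; apply/seteqP.
Qed.

Lemma continuous_bigmin {R : realType} {T : topologicalType} {I : Type}
    (s : seq I) (f0 : T -> R) (f : I -> T -> R) :
  continuous f0 -> (forall i, continuous (f i)) ->
  continuous (fun t => \big[Num.min/f0 t]_(i <- s) f i t).
Proof.
move=> cf0 cf; elim: s => [|i s IHs].
  by under eq_fun do rewrite big_nil.
under eq_fun do rewrite big_cons.
by move=> t; apply: (@continuous_min R T (f i)); [exact: cf|exact: IHs].
Qed.

Section argmax.
Context {R : realType} {T : topologicalType}.
Implicit Types (f : T -> R) (A : set T).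

Definition argmax f A : set T := [set t | A t /\ is_max (f @` A) (f t)].

Lemma argmaxE f A :
  argmax f A = A `&` \bigcap_(s in A) f @^-1` [set y | f s <= y].
Proof.
apply/seteqP; split=> t [At].
  by move=> [_ tmax]; split=> // s As; apply: tmax; exists s.
by move=> tmax; split=> //; split=> [|_ [s As <-]]; [exists t|exact: tmax].
Qed.

Lemma closed_argmax f A : continuous f -> closed A -> closed (argmax f A).
Proof.
move=> cf cA; rewrite argmaxE; apply: closedI => //.
by apply: closed_bigI => s _; apply: preimage_closed => //; exact: closed_ge.
Qed.

Lemma argmax_nonempty f A :
  continuous f -> compact A -> A !=set0 -> argmax f A !=set0.
Proof.
move=> cf coA A0.
have [c /set_mem Ac cmax] := compact_EVT_max A0 coA (continuous_subspaceT cf).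
by exists c; rewrite argmaxE; split=> // s As; exact/cmax/mem_set.
Qed.

End argmax.

Section farthest_first.
Context {R : realFieldType} {X : metricType R}.
Implicit Type phi : nat -> X.

Definition farthest_first phi := forall n x (e : R),
  (forall j, (j <= n)%N -> e <= mdist (phi j) x) ->
  forall j, (j <= n)%N -> e <= mdist (phi j) (phi n.+1).

Lemma compact_close_pair phi (e : R) : compact [set: X] -> 0 < e ->
  exists m n, (m < n)%N /\ mdist (phi m) (phi n) < e.
Proof.
move=> cX e0; have e2 : 0 < e / 2 by rewrite divr_gt0.
have [x [_ clx]] : [set: X] `&` cluster (phi @ \oo) !=set0.
  by apply: cX; exact: filterT.
have visit N : exists n, (N <= n)%N /\ mdist x (phi n) < e / 2.
  have [|y [[n /= Nn <-]]] :=
      clx (phi @` [set n | (N <= n)%N]) _ _ (nbhsx_ballx x _ e2).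
    by exists N => // n /= Nn; exists n.
  by rewrite ballEmdist /= => xn; exists n.
have [m [_ xm]] := visit 0%N.
have [n [mn xn]] := visit m.+1.
exists m, n; split=> //.
apply: (le_lt_trans (metric_triangle _ x _)).
by rewrite metric_sym (splitr e) ltrD.
Qed.

Lemma farthest_first_dense phi :
  compact [set: X] -> farthest_first phi -> dense (range phi).
Proof.
move=> cX phi_far O [x Ox] oO; apply: contrapT => O_miss.
have /nbhs_ballP[e /= e0 eO] := open_nbhs_nbhs (conj oO Ox).
have far_x j : e <= mdist (phi j) x.
  rewrite leNgt; apply/negP => jx; apply: O_miss; exists (phi j); split.
    by apply: eO; rewrite ballEmdist /= metric_sym.
  by exists j.
have [m [[|n] [//]]] := compact_close_pair phi cX e0.
by rewrite ltnS ltNge => mn; rewrite (phi_far n x).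
Qed.

Lemma infinite_away_from_finite (I : finType) (f : I -> X) :
  infinite_set [set: X] ->
  exists x, exists2 e : R, 0 < e & forall i, e <= mdist (f i) x.
Proof.
move=> iX; have [x fx] : exists x, forall i, f i != x.
  apply: contrapT => /forallNP hit; apply: iX.
  apply: (@sub_finite_set _ _ (range f)); last exact/finite_image/finite_finset.
  move=> x _; have /existsNP[i /negP] := hit x.
  by rewrite negbK => /eqP <-; exists i.
exists x, (\big[Num.min/1]_i mdist (f i) x) => [|i].
  by apply/bigmin_gtP; split=> // i _; rewrite mdist_gt0.
exact: bigmin_le_cond.
Qed.

Lemma farthest_first_inj phi :
  infinite_set [set: X] -> farthest_first phi -> injective phi.
Proof.
move=> iX phi_far.
have phi_lt j k : (j < k)%N -> phi j <> phi k.
  case: k => // n jn; apply/eqP; rewrite -mdist_gt0.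
  have [x [e e0 far_x]] :=
    infinite_away_from_finite (fun i : 'I_n.+1 => phi i) iX.
  apply: lt_le_trans e0 (phi_far n x e _ j jn) => i i_n.
  exact: far_x (Ordinal (i_n : (i < n.+1)%N)).
by move=> j k; case: (ltngtP j k) => // /phi_lt // + /esym.
Qed.

End farthest_first.

Arguments Fset {R} X n r _.

Lemma pt_last (X : Type) n (p : conf X n) : pt p n.+1 = p.2.
Proof. by rewrite /pt insubF // ltnn. Qed.

Lemma pt_ord (X : Type) n (p : conf X n) (i : 'I_n.+1) : pt p i = p.1 i.
Proof. by rewrite /pt valK. Qed.

HB.instance Definition _ (X : topologicalType) (n : nat) :=
  Topological.copy (conf X n) ({ptws 'I_n.+1 -> X} * X)%type.

Section conf_topology.
Context {X : topologicalType}.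
Implicit Type n : nat.

Lemma compact_conf n : compact [set: X] -> compact [set: conf X n].
Proof.
move=> cX; have := compact_setX (compact_ptws (I := 'I_n.+1) cX) cX.
by rewrite setXTT.
Qed.

Lemma continuous_coord n (i : 'I_n.+1) : continuous (fun p : conf X n => p.1 i).
Proof.
move=> p.
apply: (@continuous_comp _ _ _ (fst : conf X n -> {ptws _ -> _}) (proj i)).
  exact: cvg_fst.
exact: proj_continuous.
Qed.

Lemma continuous_last n : continuous (fun p : conf X n => p.2).
Proof. by move=> p; exact: cvg_snd. Qed.

Lemma continuous_pt n j : continuous (fun p : conf X n => pt p j).
Proof.
rewrite /pt; case: insub => [i|] /=; first exact: continuous_coord.
exact: continuous_last.
Qed.

End conf_topology.

Section configurations.
Context {R : realType} {X : metricType R}.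
Implicit Types (n : nat) (r : nat -> nat -> R).

Lemma continuous_fmin n : continuous (@fmin R X n).
Proof.
apply: continuous_bigmin => [|i]; apply: continuous_mdist;
  by [exact: continuous_coord|exact: continuous_last].
Qed.

Lemma le_fminP n (p : conf X n) e :
  e <= fmin p <-> forall i, e <= mdist (p.1 i) p.2.
Proof.
split=> [ep i|ep]; first exact/(le_trans ep)/bigmin_le_cond.
by apply/bigmin_geP; split=> // i _.
Qed.

Lemma closed_FsetX n r : closed (Fset X n r `*` [set: X] : set (conf X n)).
Proof.
rewrite (_ : _ `*` _ = \bigcap_(jk in [set: 'I_n.+1 * 'I_n.+1])
    [set p : conf X n | mdist (p.1 jk.1) (p.1 jk.2) = r jk.1 jk.2]).
  apply: closed_bigI => jk _.
  by apply: closed_mdist_eq; exact: continuous_coord.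
apply/seteqP; split=> p; first by move=> [Fp _] jk _; exact: Fp.
by move=> Fp; split=> // j k; exact: (Fp (j, k)).
Qed.

Lemma Aset0E n r :
  Aset X n r 0 = argmax (@fmin R X n) (Fset X n r `*` [set: X]).
Proof. by []. Qed.

Lemma AsetSE n r j :
  Aset X n r j.+1 = argmax (fun p => mdist (pt p j) p.2) (Aset X n r j).
Proof. by []. Qed.

Lemma continuous_mdist_pt n j :
  continuous (fun p : conf X n => mdist (pt p j) p.2).
Proof.
by apply: continuous_mdist; [exact: continuous_pt|exact: continuous_last].
Qed.

Lemma closed_Aset n r j : closed (Aset X n r j).
Proof.
elim: j => [|j IHj].
  rewrite Aset0E; apply: closed_argmax (@closed_FsetX n r).
  exact: continuous_fmin.
by rewrite AsetSE; apply: closed_argmax IHj; exact: continuous_mdist_pt.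
Qed.

Lemma Aset_nonempty n r j :
  compact [set: X] -> Fset X n r !=set0 -> Aset X n r j !=set0.
Proof.
move=> cX [x Fx].
have closed_compact (A : set (conf X n)) : closed A -> compact A.
  by move=> cA; exact: subclosed_compact cA (compact_conf cX) _.
elim: j => [|j IHj].
  rewrite Aset0E; apply: argmax_nonempty; first exact: continuous_fmin.
    exact/closed_compact/closed_FsetX.
  by exists (x, x ord0).
rewrite AsetSE; apply: argmax_nonempty IHj; first exact: continuous_mdist_pt.
exact/closed_compact/closed_Aset.
Qed.

Lemma Aset_sub0 n r j : Aset X n r j `<=` Aset X n r 0.
Proof. by elim: j => // j IHj p [/IHj]. Qed.

Lemma Fset_extend n r (p : conf X n) : Fset X n r p.1 ->
  Fset X n.+1 (extend_metric r p) (fun i => pt p i).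
Proof.
move=> Fp j k; rewrite /extend_metric.
case: eqP => [->|/eqP kn]; first by rewrite pt_last.
case: eqP => [->|/eqP jn]; first by rewrite pt_last metric_sym.
have lt_ord (i : 'I_n.+2) : i != n.+1 :> nat -> (i < n.+1)%N.
  by move=> i_n; rewrite ltn_neqAle i_n -ltnS ltn_ord.
by have := Fp (Ordinal (lt_ord _ jn)) (Ordinal (lt_ord _ kn)); rewrite -!pt_ord.
Qed.

Lemma compact_isometric_seq r : compact [set: X] ->
  (forall n, Fset X n r !=set0) ->
  exists phi : nat -> X, forall j k, mdist (phi j) (phi k) = r j k.
Proof.
move=> cX Fr.
have stage n : exists u : {ptws nat -> X}, forall j k,
    (j <= n)%N -> (k <= n)%N -> mdist (u j) (u k) = r j k.
  have [x Fx] := Fr n.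
  by exists (fun j => x (inord j)) => j k jn kn; rewrite Fx !inordK.
have [u ur] := choice stage.
have [phi [_ u_phi]] : [set: {ptws nat -> X}] `&` cluster (u @ \oo) !=set0.
  by apply: compact_ptws => //; exact: filterT.
exists phi => j k.
apply: (@closed_mdist_eq _ _ {ptws nat -> X} (proj j) (proj k) (r j k)).
- exact: proj_continuous.
- exact: proj_continuous.
move=> B /u_phi; apply; exists (maxn j k) => // n /=.
by rewrite geq_max => /andP[jn kn]; exact: ur.
Qed.

End configurations.

Section rho.
Context {R : realType} {X : metricType R}.

Lemma rho_stage_stable m n j k : (j <= m)%N -> (k <= m)%N -> (m <= n)%N ->
  rho_stage X n j k = rho_stage X m j k.
Proof.
move=> jm km /subnKC <-; elim: (n - m)%N => [|d IHd]; first by rewrite addn0.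
rewrite addnS -IHd /=; case: xgetP => // _ _ [p _ <-].
by rewrite /extend_metric !ltn_eqF // ltnS (leq_trans _ (leq_addr _ _)).
Qed.

Lemma rho_stageE n j k : (j <= n)%N -> (k <= n)%N ->
  rho_stage X n j k = rho X j k.
Proof.
move=> jn kn; rewrite /rho (rho_stage_stable (m := maxn j k)) //.
- exact: leq_maxl.
- exact: leq_maxr.
- by rewrite geq_max jn.
Qed.

Lemma Fset_rho n : Fset X n (rho X) = Fset X n (rho_stage X n).
Proof.
by apply/seteqP; split=> x Fx j k; rewrite Fx rho_stageE // -ltnS.
Qed.

Hypothesis cX : compact [set: X].

Lemma rho_stage_succ n : Fset X n (rho_stage X n) !=set0 ->
  exists2 p, Aset X n (rho_stage X n) n.+1 p &
    rho_stage X n.+1 = extend_metric (rho_stage X n) p.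
Proof.
move=> /(Aset_nonempty n.+1 cX)[p Ap] /=.
case: xgetP => [_ _ [q Aq <-]|/(_ (extend_metric (rho_stage X n) p))].
  by exists q.
by case; exists p.
Qed.

Lemma Fset_rho_nonempty n : [set: X] !=set0 -> Fset X n (rho X) !=set0.
Proof.
move=> [x _]; rewrite Fset_rho; elim: n => [|n IHn].
  by exists (fun=> x) => j k; rewrite mdistxx.
have [p /Aset_sub0[[Fp _] _] ->] := rho_stage_succ IHn.
by exists (fun i => pt p i); exact: Fset_extend.
Qed.

Lemma rho_farthest_first (phi : nat -> X) :
  (forall j k, mdist (phi j) (phi k) = rho X j k) -> farthest_first phi.
Proof.
move=> phi_rho n x e far_x j jn; rewrite phi_rho.
pose phi_n (i : 'I_n.+1) := phi i.
have Fphi : Fset X n (rho_stage X n) phi_n.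
  by rewrite -Fset_rho => i k; exact: phi_rho.
have [p Ap rhoS] := rho_stage_succ (ex_intro _ _ Fphi).
rewrite -(@rho_stageE n.+1) // ?(leq_trans jn) // rhoS /extend_metric eqxx.
have [_ [_ fmin_max]] := Aset_sub0 Ap.
have e_p : e <= fmin p.
  apply: (@le_trans _ _ (fmin (phi_n, x))); last first.
    by apply: fmin_max; exists (phi_n, x).
  by apply/le_fminP => i; apply: far_x; rewrite -ltnS.
by have := (le_fminP p e).1 e_p (Ordinal (jn : (j < n.+1)%N)); rewrite -pt_ord.
Qed.

End rho.

Theorem proposition6p1 (R : realType) (X : metricType R)
    (cX : compact [set: X]) (iX : infinite_set [set: X]) :
  exists D : set X, dense D /\
    exists phi : nat -> X, set_bij [set: nat] D phi /\
      forall j k : nat, mdist (phi j) (phi k) = rho X j k.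
Proof.
have [phi phi_rho] : exists phi : nat -> X,
    forall j k, mdist (phi j) (phi k) = rho X j k.
  apply: compact_isometric_seq => // n.
  exact/(Fset_rho_nonempty cX)/infinite_setN0.
have phi_far := rho_farthest_first cX phi_rho.
exists (range phi); split; first exact: farthest_first_dense.
exists phi; split=> //; apply: inj_bij => j k _ _.
exact: farthest_first_inj.
Qed.
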